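(* Let $(X_a,\mathcal{X}_a)$, $(X_b,\mathcal{X}_b)$, $(Y_a,\mathcal{Y}_a)$, $(Y_b,\mathcal{Y}_b)$ be measurable spaces, and put $(X,\mathcal{X})=(X_a,\mathcal{X}_a)\otimes(X_b,\mathcal{X}_b)$ and $(Y,\mathcal{Y})=(Y_a,\mathcal{Y}_a)\otimes(Y_b,\mathcal{Y}_b)$. Assume that the $\sigma$-algebras $\mathcal{X}$ and $\mathcal{Y}$ are countably generated. Let $\mathcal{U}$ be the set of Borel subsets of $[0,1]$ and let $u$ be Lebesgue measure on $\mathcal{U}$. Then for every measurable space $(\Lambda,\mathcal{L})$ and every hidden-variable model $p$ with hidden variables in $(\Lambda,\mathcal{L})$ (i.e. every probability measure $p$ on $(X,\mathcal{X})\otimes(Y,\mathcal{Y})\otimes(\Lambda,\mathcal{L})$), there is a hidden-variable model $\overline{p}$, that is, a probability measure on $(X,\mathcal{X})\otimes(Y,\mathcal{Y})\otimes([0,1],\mathcal{U})$, such that: (i) the hidden-variable space of $\overline{p}$ is $([0,1],\mathcal{U},u)$, i.e. $\mathrm{marg}_{[0,1]}\overline{p}=u$; (ii) $\overline{p}$ is realization-equivalent to $p$, i.e. $\mathrm{marg}_{X\times Y}\overline{p}=\mathrm{marg}_{X\times Y}p$; (iii) for each of the properties parameter independence, outcome independence (and therefore also locality), $\lambda$-independence, strong determinism, and weak determinism, if $p$ has the property then so does $\overline{p}$.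
   Context: $\otimes$ denotes the product of measurable spaces (product $\sigma$-algebra). $\mathrm{marg}$ denotes the marginal of a measure on the indicated factor(s). A hidden-variable model with hidden variables in a measurable space $(\Lambda,\mathcal{L})$ is a probability measure $p$ on $(X,\mathcal{X})\otimes(Y,\mathcal{Y})\otimes(\Lambda,\mathcal{L})$, where $(X,\mathcal{X})=(X_a,\mathcal{X}_a)\otimes(X_b,\mathcal{X}_b)$ and $(Y,\mathcal{Y})=(Y_a,\mathcal{Y}_a)\otimes(Y_b,\mathcal{Y}_b)$. Its hidden-variable space is the probability space $(\Lambda,\mathcal{L},\ell)$ with $\ell=\mathrm{marg}_\Lambda p$. An empirical model is a probability measure $e$ on $(X,\mathcal{X})\otimes(Y,\mathcal{Y})$; $p$ realizes $e$ if $e=\mathrm{marg}_{X\times Y}p$; two hidden-variable models (possibly with different $\Lambda$) are realization-equivalent if they realize the same empirical model. Conditional probability notation: for a probability measure $p$ on a finite product of measurable spaces, a measurable set $J$ in the product of some of the factors, and the product $\sigma$-algebra $\mathcal{Z}$ of some other factors (with product set $Z$), $p[J||\mathcal{Z}]:Z\to[0,1]$ is the conditional probability under $p$ of the cylinder set over $J$ given the $\sigma$-algebra of cylinder sets over members of $\mathcal{Z}$, regarded as a $\mathcal{Z}$-measurable function on $Z$ (unique up to $p$-almost sure equality); its value at $z$ is $p[J||\mathcal{Z}]_z$. A set in a factor is identified with its cylinder, so $p(L)$ means $\mathrm{marg}_\Lambda p\,(L)$ for $L\in\mathcal{L}$. All equations and membership statements involving conditional probabilities are understood to hold $p$-almost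 surely. Properties of a hidden-variable model $p$ (with $(\Lambda,\mathcal{L})$ its space of hidden variables): - Locality: for every $J_a\in\mathcal{X}_a$, $J_b\in\mathcal{X}_b$, $p[J_a\times J_b||\mathcal{Y}\otimes\mathcal{L}]=p[J_a||\mathcal{Y}_a\otimes\mathcal{L}]\cdot p[J_b||\mathcal{Y}_b\otimes\mathcal{L}]$. - Parameter independence: for every $J_a\in\mathcal{X}_a$, $p[J_a||\mathcal{Y}\otimes\mathcal{L}]=p[J_a||\mathcal{Y}_a\otimes\mathcal{L}]$, and likewise with $a$ replaced by $b$. - Outcome independence: for every $J_a\in\mathcal{X}_a$, $J_b\in\mathcal{X}_b$, $p[J_a\times J_b||\mathcal{Y}\otimes\mathcal{L}]=p[J_a||\mathcal{Y}\otimes\mathcal{L}]\cdot p[J_b||\mathcal{Y}\otimes\mathcal{L}]$. - $\lambda$-independence: for every $L\in\mathcal{L}$, $p[L||\mathcal{Y}]_y=p(L)$. - Strong determinism: for every $J_a\in\mathcal{X}_a$, $p[J_a||\mathcal{Y}_a\otimes\mathcal{L}]_{(y_a,\lambda)}\in\{0,1\}$, and likewise with $a$ replaced by $b$. - Weak determinism: for every $J_a\in\mathcal{X}_a$, $J_b\in\mathcal{X}_b$, $p[J_a\times J_b||\mathcal{Y}\otimes\mathcal{L}]_{(y,\lambda)}\in\{0,1\}$. For $\overline{p}$ these properties are read with $([0,1],\mathcal{U})$ in place of $(\Lambda,\mathcal{L})$. *)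

(* Defs.v *)
From HB Require Import structures.
From mathcomp Require Import all_boot all_order all_algebra.
From mathcomp Require Import all_classical all_reals all_analysis.
From mathcomp Require Import measurable_realfun.

Set Implicit Arguments.
Unset Strict Implicit.
Unset Printing Implicit Defensive.

Import Order.TTheory GRing.Theory Num.Theory.
Import numFieldNormedType.Exports.

Local Open Scope classical_set_scope.
Local Open Scope ring_scope.

Definition countably_generated d (T : measurableType d) : Prop :=
  exists G : set (set T), countable G /\ @measurable d T = <<s G >>.

Definition unit_itv (R : realType) : Type := {x : R | x \in `[0%R, 1%R]}.

HB.instance Definition _ (R : realType) := SubChoice.on (unit_itv R).

Lemma zero_in_unit_itv (R : realType) : (0 : R) \in `[0%R, 1%R].
Proof. by rewrite in_itv/= lexx ler01. Qed.

HB.instance Definition _ (R : realType) :=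
  isPointed.Build (unit_itv R) (exist _ 0 (zero_in_unit_itv R)).

Definition unit_val (R : realType) (x : unit_itv R) : R := \val x.

(* The measurable sets are the traces on [0,1] of the Borel sets of R. *)
HB.instance Definition _ (R : realType) :=
  Measurable.copy (unit_itv R) (g_sigma_algebra_preimageType (@unit_val R)).

Definition unit_lebesgue (R : realType) (B : set (unit_itv R)) : \bar R :=
  lebesgue_measure (@unit_val R @` B).

Section unit_lebesgue_probability.
Context (R : realType).

Lemma unit_val_inj : injective (@unit_val R).
Proof. exact: val_inj. Qed.

Lemma image_unit_val_preimage (B : set R) :
  @unit_val R @` (@unit_val R @^-1` B) = `[0, 1]%classic `&` B.
Proof.
apply/seteqP; split=> [_ [x Bx <-]|x [x01 Bx]].
  by split => //; rewrite /unit_val/=; case: x {Bx}.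
have x01' : x \in `[0%R, 1%R] by [].
by exists (exist _ x x01').
Qed.

Lemma measurable_image_unit_val (B : set (unit_itv R)) :
  measurable B -> measurable (@unit_val R @` B).
Proof.
move=> [C mC <-]; rewrite setTI image_unit_val_preimage.
by apply: measurableI => //; exact: measurable_itv.
Qed.

Let ul0 : unit_lebesgue (@set0 (unit_itv R)) = 0%E.
Proof. by rewrite /unit_lebesgue image_set0 measure0. Qed.

Let ul_ge0 (B : set (unit_itv R)) : (0 <= unit_lebesgue B)%E.
Proof. exact: measure_ge0. Qed.

Let ul_sigma : semi_sigma_additive (@unit_lebesgue R).
Proof.
move=> F mF tF mUF; rewrite /unit_lebesgue image_bigcup.
apply: (@measure_semi_sigma_additive _ _ _ (@lebesgue_measure R)
   (fun i => @unit_val R @` F i)).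
- by move=> i; exact: measurable_image_unit_val.
- apply/trivIsetP => i j _ _ ij; move/trivIsetP : tF => /(_ i j I I ij) Fij.
  rewrite -subset0 => _ [[x Fx <-] [y Fy /unit_val_inj yx]].
  have : (F i `&` F j) x by split => //; rewrite -yx.
  by rewrite Fij.
- rewrite -image_bigcup; exact: measurable_image_unit_val.
Qed.

HB.instance Definition _ := isMeasure.Build _ _ _ (@unit_lebesgue R)
  ul0 ul_ge0 ul_sigma.

Let ulT : unit_lebesgue [set: unit_itv R] = 1%:E.
Proof.
have -> : [set: unit_itv R] = @unit_val R @^-1` setT by [].
rewrite /unit_lebesgue image_unit_val_preimage setIT.
by rewrite lebesgue_measure_itv/= lte01 oppr0 adde0.
Qed.

HB.instance Definition _ := Measure_isProbability.Build _ _ _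
  (@unit_lebesgue R) ulT.

End unit_lebesgue_probability.

Section conditional_probability.
Context d (T : measurableType d) dZ (Z : measurableType dZ) (R : realType).
Variables (P : probability T R) (A : set T) (f : T -> Z).

(* [g] is a version of the conditional probability of the event [A] given
   the sigma-algebra [f @^-1` B], B measurable in Z, regarded as a function
   on Z. *)
Definition cond_prob_version (g : Z -> R) : Prop :=
  [/\ measurable_fun setT g, (forall z, 0 <= g z <= 1) &
      forall B, measurable B ->
        P (A `&` f @^-1` B) = (\int[P]_(w in f @^-1` B) (g (f w))%:E)%E].

(* A fixed but arbitrary version; by [cond_probP] and [cond_prob_version_ae]
   below, for measurable [A] and [f] a version exists and any two of them
   agree almost surely. *)
Definition cond_prob : Z -> R := xget (cst 0) [set g | cond_prob_version g].

Hypotheses (mA : measurable A) (mf : measurable_fun setT f).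

Let mf_mixin := isMeasurableFun.Build _ _ _ _ _ mf.
Let mf_pack : {mfun T >-> Z} := HB.pack f mf_mixin.

Let mpre B : measurable B -> measurable (f @^-1` B).
Proof. by move=> mB; rewrite -[_ @^-1` _]setTI; exact: mf. Qed.

Let cond_prob_version_integral (g : Z -> R) : measurable_fun setT g ->
  (forall z, 0 <= g z) -> forall B, measurable B ->
  (\int[distribution P mf_pack]_(z in B) (g z)%:E =
   \int[P]_(w in f @^-1` B) (g (f w))%:E)%E.
Proof.
move=> mg g0 B mB; rewrite ge0_integral_pushforward//.
- exact/measurable_EFinP/measurable_funTS.
- by move=> y _; rewrite lee_fin.
Qed.

Lemma cond_prob_version_exists : exists g, cond_prob_version g.
Proof.
pose mu : probability Z R := distribution P mf_pack.
pose push : {measure set Z -> \bar R} := pushforward (mrestr P mA) f.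
pose pushf : {measure set Z -> \bar R} := push mf.
pose nu0 (B : set Z) : \bar R := P (f @^-1` B `&` A).
have nu_meas : isMeasure _ _ _ nu0.
  exact: (isMeasure.Build _ _ _ nu0 (measure0 pushf) (measure_ge0 pushf)
    (@measure_semi_sigma_additive _ _ _ pushf)).
pose nu1 : {measure set Z -> \bar R} := HB.pack nu0 nu_meas.
have nu_fin : fin_num_fun nu1.
  move=> B mB; apply: (fin_num_measure P); apply: measurableI => //.
  exact: mpre.
pose nu_finite := Measure_isFinite.Build _ _ _ nu1 nu_fin.
pose nu : {finite_measure set Z -> \bar R} := HB.pack nu0 nu_meas nu_finite.
have nu_le B : measurable B -> (nu B <= mu B)%E.
  move=> mB; apply: le_measure; rewrite ?inE//.
  - by apply: measurableI => //; exact: mpre.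
  - exact: mpre.
have numu : nu `<< mu.
  apply/null_content_dominatesP => B mB B0; apply/eqP.
  by rewrite eq_le measure_ge0 andbT -B0 nu_le.
have [h [h0 hfin hint hE]] := radon_nikodym_sigma_finite numu.
have mh : measurable_fun setT h by exact: measurable_int hint.
pose g z := fine (mine (h z) 1%E).
have gE z : (g z)%:E = mine (h z) 1%E.
  by rewrite /g fineK// /mine; case: ifP.
have mg : measurable_fun setT g.
  apply/measurable_EFinP; rewrite (_ : _ \o _ = fun z => mine (h z) 1%E).
    exact: measurable_mine.
  exact/funext.
have g01 z : 0 <= g z <= 1.
  by rewrite -!lee_fin gE le_min h0 lee_fin ler01 ge_min lexx orbT.
exists g; split => // B mB.
pose E := [set z | (1 < h z)%E].
have mE : measurable E.
  by rewrite -[E]setTI; exact: emeasurable_fun_o_infty.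
have hE1 : ae_eq mu E h (cst 1%E).
  apply: integral_ae_eq => //; first exact: integrableS hint.
  move=> F FE mF; apply/eqP; rewrite eq_le; apply/andP; split.
    by rewrite -hE// integral_cst// mul1e; exact: nu_le.
  apply: ge0_le_integral => //; first exact: measurable_funTS.
  by move=> z /FE /ltW.
have hg : ae_eq mu B h (EFin \o g).
  apply: filterS hE1 => z hz _ /=; rewrite gE /mine; case: ltP => // h1.
  move: h1; rewrite le_eqVlt => /predU1P[<- //|/[dup] h1 /hz h1'].
  exact: h1'.
transitivity (nu B); first by rewrite /nu/= /pushforward/= /mrestr setIC.
rewrite -cond_prob_version_integral//; last first.
  by move=> z; have /andP[] := g01 z.
rewrite hE//; apply: ae_eq_integral => //; first exact: measurable_funTS.
exact/measurable_funTS/measurable_EFinP.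
Qed.

Lemma cond_probP : cond_prob_version cond_prob.
Proof.
rewrite /cond_prob; case: xgetP => // noversion.
by have [g gv] := cond_prob_version_exists; case: (noversion g).
Qed.

Lemma cond_prob_version_ae (g1 g2 : Z -> R) :
  cond_prob_version g1 -> cond_prob_version g2 ->
  {ae P, forall w, g1 (f w) = g2 (f w)}.
Proof.
move=> [mg1 g1_01 g1E] [mg2 g2_01 g2E].
have g1_0 z : 0 <= g1 z by have /andP[] := g1_01 z.
have g2_0 z : 0 <= g2 z by have /andP[] := g2_01 z.
pose mu : probability Z R := distribution P mf_pack.
have : ae_eq mu setT (EFin \o g1) (EFin \o g2).
  apply: integral_ae_eq => //.
  - apply: (@le_integrable _ _ _ mu _ measurableT _ (cst 1%E)).
    + exact/measurable_EFinP.
    + move=> z _; rewrite /= lee_fin normr1 ger0_norm//.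
      by have /andP[] := g1_01 z.
    + exact: finite_measure_integrable_cst.
  - exact/measurable_EFinP.
  - move=> B _ mB.
    by rewrite !cond_prob_version_integral// -g1E// -g2E.
move=> [N [mN N0 gN]]; exists (f @^-1` N); split => //; first exact: mpre.
by move=> w /= gw; apply: gN => /= /(_ I) [].
Qed.

End conditional_probability.

Arguments cond_prob {d T dZ Z R} P A f.
Arguments cond_prob_version {d T dZ Z R} P A f g.

Notation empirical_model Xa Xb Ya Yb R :=
  (probability ((Xa * Xb) * (Ya * Yb))%type R).

Notation hidden_variable_model Xa Xb Ya Yb L R :=
  (probability ((Xa * Xb) * (Ya * Yb) * L)%type R).

Section projections.
Context {Xa Xb Ya Yb L : Type}.
Implicit Types w : (Xa * Xb) * (Ya * Yb) * L.

Definition projXY w : (Xa * Xb) * (Ya * Yb) := w.1.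
Definition projX w : Xa * Xb := w.1.1.
Definition projXa w : Xa := w.1.1.1.
Definition projXb w : Xb := w.1.1.2.
Definition projY w : Ya * Yb := w.1.2.
Definition projL w : L := w.2.
Definition projYL w : (Ya * Yb) * L := (w.1.2, w.2).
Definition projYaL w : Ya * L := (w.1.2.1, w.2).
Definition projYbL w : Yb * L := (w.1.2.2, w.2).

End projections.

Section hidden_variable_models.
Context {R : realType} {da db ea eb dl : measure_display}
  {Xa : measurableType da} {Xb : measurableType db}
  {Ya : measurableType ea} {Yb : measurableType eb} {L : measurableType dl}.
Implicit Types (p : hidden_variable_model Xa Xb Ya Yb L R)
  (e : empirical_model Xa Xb Ya Yb R).

Definition realizes p e : Prop :=
  forall B, measurable B -> e B = pushforward p projXY B.

Definition locality p : Prop :=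
  forall (Ja : set Xa) (Jb : set Xb), measurable Ja -> measurable Jb ->
    {ae p, forall w, cond_prob p (projX @^-1` (Ja `*` Jb)) projYL (projYL w) =
      cond_prob p (projXa @^-1` Ja) projYaL (projYaL w) *
      cond_prob p (projXb @^-1` Jb) projYbL (projYbL w)}.

Definition parameter_independence p : Prop :=
  (forall Ja : set Xa, measurable Ja ->
    {ae p, forall w, cond_prob p (projXa @^-1` Ja) projYL (projYL w) =
      cond_prob p (projXa @^-1` Ja) projYaL (projYaL w)}) /\
  (forall Jb : set Xb, measurable Jb ->
    {ae p, forall w, cond_prob p (projXb @^-1` Jb) projYL (projYL w) =
      cond_prob p (projXb @^-1` Jb) projYbL (projYbL w)}).

Definition outcome_independence p : Prop :=
  forall (Ja : set Xa) (Jb : set Xb), measurable Ja -> measurable Jb ->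
    {ae p, forall w, cond_prob p (projX @^-1` (Ja `*` Jb)) projYL (projYL w) =
      cond_prob p (projXa @^-1` Ja) projYL (projYL w) *
      cond_prob p (projXb @^-1` Jb) projYL (projYL w)}.

Definition lambda_independence p : Prop :=
  forall K : set L, measurable K ->
    {ae p, forall w, (cond_prob p (projL @^-1` K) projY (projY w))%:E =
      pushforward p projL K}.

Definition strong_determinism p : Prop :=
  (forall Ja : set Xa, measurable Ja ->
    {ae p, forall w,
      cond_prob p (projXa @^-1` Ja) projYaL (projYaL w) \in [:: 0; 1]}) /\
  (forall Jb : set Xb, measurable Jb ->
    {ae p, forall w,
      cond_prob p (projXb @^-1` Jb) projYbL (projYbL w) \in [:: 0; 1]}).

Definition weak_determinism p : Prop :=
  forall (Ja : set Xa) (Jb : set Xb), measurable Ja -> measurable Jb ->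
    {ae p, forall w,
      cond_prob p (projX @^-1` (Ja `*` Jb)) projYL (projYL w) \in [:: 0; 1]}.

End hidden_variable_models.

Definition realization_equivalent {R : realType}
    {da db ea eb dl dm : measure_display}
    {Xa : measurableType da} {Xb : measurableType db}
    {Ya : measurableType ea} {Yb : measurableType eb}
    {L : measurableType dl} {M : measurableType dm}
    (p : hidden_variable_model Xa Xb Ya Yb L R)
    (q : hidden_variable_model Xa Xb Ya Yb M R) : Prop :=
  exists e : empirical_model Xa Xb Ya Yb R, realizes p e /\ realizes q e.

(* Main.v *)
Require Import Defs.
From HB Require Import structures.
From mathcomp Require Import all_boot all_order all_algebra.
From mathcomp Require Import all_classical all_reals all_analysis.
From mathcomp Require Import measurable_realfun ring lra.

(* Only countably many sets K_n of values of the hidden variable la matter: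
   they generate enough to compute the conditional probabilities, given
   (y, la), (y_a, la) and (y_b, la), of a countable pi-system of events in X.
   A ternary code turns the K_n into one real random variable phi.  Its
   distributional transform t, in which the jumps of the distribution function
   of phi are filled in by an independent uniform variable v, is uniform on
   [0,1] and determines phi almost surely.  Hence t is a function of la and of
   independent noise that still knows every K_n, so that conditioning on t
   instead of la changes none of the relevant conditional probabilities.  The
   new model is the law of (x, y, t). *)

Set Implicit Arguments.
Unset Strict Implicit.
Unset Printing Implicit Defensive.

Import Order.TTheory GRing.Theory Num.Theory.
Import numFieldNormedType.Exports.

Local Open Scope classical_set_scope.
Local Open Scope ring_scope.

(** * Laws and conditional probabilities *)

(** Turns membership in {0, 1} into an equation between measurable functions, so that determinism
    can be moved between laws by [ae_law_eq]. *)
Lemma in01_idem (R : realType) (x : R) : (x \in [:: 0; 1]) = (x * x == x).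
Proof.
rewrite !inE -[X in _ = (_ == X)]mulr1 -[RHS]subr_eq0 -mulrBr mulf_eq0.
by rewrite subr_eq0.
Qed.

Section law.
Context d (T : measurableType d) dZ (Z : measurableType dZ) (R : realType).
Variables (P : probability T R) (f : T -> Z) (mf : measurable_fun setT f).

Lemma measurable_preimage B : measurable B -> measurable (f @^-1` B).
Proof. by move=> mB; rewrite -[_ @^-1` _]setTI; exact: mf. Qed.

Let mf_mixin := isMeasurableFun.Build _ _ _ _ _ mf.
Let mf_pack : {mfun T >-> Z} := HB.pack f mf_mixin.

Definition law : probability Z R := distribution P mf_pack.

Lemma lawE B : law B = P (f @^-1` B). Proof. by []. Qed.

Lemma ge0_integral_law (g : Z -> \bar R) B : measurable B ->
  measurable_fun setT g -> (forall z, 0 <= g z)%E ->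
  (\int[law]_(z in B) g z = \int[P]_(w in f @^-1` B) g (f w))%E.
Proof.
move=> mB mg g0; rewrite ge0_integral_pushforward//; exact: measurable_funTS.
Qed.

Lemma ae_law (Q : set Z) : {ae law, forall z, Q z} ->
  {ae P, forall w, Q (f w)}.
Proof.
move=> [N [mN N0 QN]]; exists (f @^-1` N); split => //.
  exact: measurable_preimage.
by move=> w /= Qw; exact: QN.
Qed.

(** In general a set with negligible preimage need not be negligible under the law. Here the
    exceptional set is itself measurable, so its law is the probability of its preimage, which is
    zero. *)
Lemma ae_law_eq (g h : Z -> R) :
  measurable_fun setT g -> measurable_fun setT h ->
  {ae P, forall w, g (f w) = h (f w)} -> {ae law, forall z, g z = h z}.
Proof.
move=> mg mh gh.
have mE : measurable [set z | g z = h z].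
  rewrite (_ : [set z | _] = (fun z => g z == h z) @^-1` [set true]).
    rewrite -[X in measurable X]setTI.
    exact: measurable_fun_eqr.
  by apply/seteqP; split=> z /= /eqP.
apply/negligibleP; first exact: measurableC.
apply: (measure_negligible _ gh).
exact: (measurable_preimage (measurableC mE)).
Qed.

Lemma ae_law_in01 (g : Z -> R) : measurable_fun setT g ->
  {ae P, forall w, g (f w) \in [:: 0; 1]} ->
  {ae law, forall z, g z \in [:: 0; 1]}.
Proof.
move=> mg g01.
have idem : {ae P, forall w, (g \* g) (f w) = g (f w)}.
  by apply: filterS g01 => w; rewrite in01_idem => /eqP.
by apply: filterS (ae_law_eq (measurable_funM mg mg) mg idem) => z /eqP;
  rewrite -in01_idem.
Qed.

End law.

(** Reduces recovering a whole sigma-algebra, up to null sets, to recovering its generators; a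
    countable union costs only countably many null sets. *)
Lemma ae_factor_sigma_algebra d (T : measurableType d) (Z1 : Type) d2
    (Z2 : measurableType d2) (R : realType) (P : probability T R)
    (f : T -> Z1) (g : T -> Z2) :
  sigma_algebra setT [set B | exists2 U, measurable U &
    {ae P, forall w, B (f w) <-> U (g w)}].
Proof.
split.
- by exists set0 => //; exact: aeW.
- move=> B [U mU BU]; exists (~` U); first exact: measurableC.
  apply: filterS BU => w BU; split=> [[_ + /BU]|nU]; first exact.
  by split => // /BU.
- move=> B /(_ _)/cid2 BU.
  exists (\bigcup_n s2val (BU n)).
    by apply: bigcup_measurable => n _; exact: s2valP (BU n).
  have := ae_foralln (fun n => s2valP' (BU n)); apply: filterS => w BUw.
  by split=> -[n _ /BUw Un]; exists n.
Qed.

Section cond_prob.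
Context d (T : measurableType d) dZ (Z : measurableType dZ) (R : realType).
Variables (P : probability T R) (f : T -> Z) (mf : measurable_fun setT f).

Lemma measurable_cond_prob (A : set T) : measurable A ->
  measurable_fun setT (cond_prob P A f).
Proof. by move=> mA; have [] := cond_probP P mA mf. Qed.

Lemma measurable_cond_prob_comp (A : set T) : measurable A ->
  measurable_fun setT (fun w => cond_prob P A f (f w)).
Proof. by move=> /measurable_cond_prob mg; exact: (measurableT_comp mg mf). Qed.

Lemma cond_prob_ge0 (A : set T) z : measurable A -> 0 <= cond_prob P A f z.
Proof. by move=> mA; have [_ /(_ z)/andP[]] := cond_probP P mA mf. Qed.

Lemma cond_prob_le1 (A : set T) z : measurable A -> cond_prob P A f z <= 1.
Proof. by move=> mA; have [_ /(_ z)/andP[]] := cond_probP P mA mf. Qed.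

Lemma integral_cond_prob (A : set T) B : measurable A -> measurable B ->
  P (A `&` f @^-1` B) =
  (\int[P]_(w in f @^-1` B) (cond_prob P A f (f w))%:E)%E.
Proof. by move=> mA mB; have [_ _ ->] := cond_probP P mA mf. Qed.

(** Both sides have the same integrals against the law of [f], hence agree there almost everywhere,
    and [ae_law] pulls this back. The candidate [g] is extended-real so that it can be a series or a
    supremum. *)
Lemma cond_prob_unique (A : set T) (g : Z -> \bar R) : measurable A ->
  measurable_fun setT g -> (forall z, 0 <= g z)%E ->
  (forall B, measurable B ->
    P (A `&` f @^-1` B) = \int[P]_(w in f @^-1` B) g (f w))%E ->
  {ae P, forall w, (cond_prob P A f (f w))%:E = g (f w)}.
Proof.
move=> mA mg g0 gE.
have mh := measurable_cond_prob mA.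
have : ae_eq (law P mf) setT (EFin \o cond_prob P A f) g.
  apply: integral_ae_eq => //.
  - apply: (@le_integrable _ _ _ (law P mf) _ measurableT _ (cst 1%E)).
    + exact/measurable_EFinP.
    + move=> z _; rewrite /= lee_fin normr1 ger0_norm ?cond_prob_ge0//.
      exact: cond_prob_le1.
    + exact: finite_measure_integrable_cst.
  - move=> B _ mB; rewrite (ge0_integral_law P mf mB mg g0) -gE//.
    rewrite integral_cond_prob//.
    apply: (ge0_integral_law P mf mB); first exact/measurable_EFinP.
    by move=> z; rewrite lee_fin cond_prob_ge0.
move=> gh; apply: (@ae_law _ _ _ _ _ P f mf
  [set z | (cond_prob P A f z)%:E = g z]).
by apply: filterS gh => z /(_ I).
Qed.

Lemma cond_probC (A : set T) : measurable A ->
  {ae P, forall w, cond_prob P (~` A) f (f w) = 1 - cond_prob P A f (f w)}.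
Proof.
move=> mA.
have := @cond_prob_unique (~` A) (fun z => (1 - cond_prob P A f z)%:E)
  (measurableC mA).
have mh := measurable_cond_prob mA.
have m1h : measurable_fun setT (fun z => (1 - cond_prob P A f z)%:E).
  by apply/measurable_EFinP; exact: measurable_funB.
move=> /(_ m1h) [| |//].
- by move=> z; rewrite lee_fin subr_ge0 cond_prob_le1.
- move=> B mB.
  have mfB := measurable_preimage mf mB.
  have mhf : measurable_fun setT (fun w => cond_prob P A f (f w)).
    exact: (measurableT_comp mh mf).
  under eq_integral do rewrite EFinB.
  have hi : P.-integrable (f @^-1` B)
      (fun w => (cond_prob P A f (f w))%:E).
    apply: (@le_integrable _ _ _ P _ mfB _ (cst 1%E)).
    + by apply/measurable_EFinP/measurable_funTS.
    + move=> z _; rewrite /= lee_fin normr1 ger0_norm ?cond_prob_ge0//.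
      exact: cond_prob_le1.
    + exact: finite_measure_integrable_cst.
  rewrite integralB//; last exact: finite_measure_integrable_cst.
  rewrite integral_cst// mul1e -integral_cond_prob//.
  rewrite setIC -setDE measureD//.
    by rewrite [in RHS]setIC.
  by rewrite ltey_eq fin_num_measure.
- by move=> N [mN N0 NP]; exists N; split => // w /= hw; apply: NP => /= -[].
Qed.

Lemma cond_prob_bigcup (A : (set T)^nat) : (forall n, measurable (A n)) ->
  trivIset setT A ->
  {ae P, forall w, (cond_prob P (\bigcup_n A n) f (f w))%:E =
    (\sum_(n <oo) (cond_prob P (A n) f (f w))%:E)%E}.
Proof.
move=> mA tA; 
apply: (@cond_prob_unique (\bigcup_n A n)
  (fun z => \sum_(n <oo) (cond_prob P (A n) f z)%:E)%E).
- exact: bigcup_measurable.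
- apply: ge0_emeasurable_sum => //.
  + by move=> n z _ _; rewrite lee_fin cond_prob_ge0.
  + by move=> n _; apply/measurable_EFinP/measurable_cond_prob.
- by move=> z; apply: nneseries_ge0 => n _ _; rewrite lee_fin cond_prob_ge0.
- move=> B mB; have mfB := measurable_preimage mf mB.
  rewrite integral_nneseries//.
  + rewrite setI_bigcupl measure_bigcup//.
    * rewrite (@eq_eseriesl R _ predT); last by move=> n; rewrite in_setT.
      by apply: eq_eseriesr => n _; exact: integral_cond_prob.
    * by move=> n _; exact: measurableI.
    * exact: trivIset_setIr.
  + move=> n; apply/measurable_EFinP/measurable_funTS.
    by apply: (measurableT_comp (measurable_cond_prob (mA n)) mf).
  + by move=> n w _; rewrite lee_fin cond_prob_ge0.
Qed.

End cond_prob.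

(** An equality of functions, not only almost surely: by change of variables both sides have the
    same set of versions, and [xget] selects from that set. *)
Lemma cond_prob_law d (T : measurableType d) d' (T' : measurableType d')
    dZ (Z : measurableType dZ) (R : realType) (P : probability T R)
    (h : T -> T') (mh : measurable_fun setT h) (A : set T') (f : T' -> Z) :
  measurable A -> measurable_fun setT f ->
  cond_prob (law P mh) A f = cond_prob P (h @^-1` A) (f \o h).
Proof.
move=> mA mf.
have intE (g : Z -> R) : measurable_fun setT g -> (forall z, 0 <= g z <= 1) ->
    forall B, measurable B ->
    (\int[law P mh]_(w in f @^-1` B) (g (f w))%:E =
     \int[P]_(w in (f \o h) @^-1` B) (g ((f \o h) w))%:E)%E.
  move=> mg g01 B mB.
  apply: (ge0_integral_law P mh (measurable_preimage mf mB)
    (g := fun w => (g (f w))%:E)).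
  - by apply/measurable_EFinP; exact: measurableT_comp mg mf.
  - by move=> z; rewrite lee_fin; have /andP[] := g01 (f z).
rewrite /cond_prob; congr xget; apply/funext => g /=.
apply/propext; split=> -[mg g01 gE]; split => // B mB.
  rewrite -[RHS](intE g mg g01 B mB); exact: gE.
rewrite [RHS](intE g mg g01 B mB); exact: gE.
Qed.

(** * Countably generated sigma-algebras *)

(** Finite intersections of an enumerated generator are indexed by finite sequences of naturals,
    hence are countably many; the empty sequence gives [setT]. Closure under intersection serves the
    Dynkin induction in [transfers_countable]. *)
Lemma countable_setI_closed_generator d (T : measurableType d) :
  countably_generated T ->
  exists G : set (set T), [/\ countable G, G setT, setI_closed G &
    @measurable d T = <<s G >>].
Proof.
move=> [G0 [cG0 mG0]].
have /pcard_surjP[e eG0] := cG0.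
(* [e] covers [G0] but may also take values outside it; these are replaced by the harmless
   [setT]. *)
pose e' n := if e n \in G0 then e n else setT.
pose cap (s : seq nat) := \big[setI/setT]_(i <- s) e' i.
exists (range cap); split.
- by apply: sub_countable (card_image_le _ _) _.
- by exists [::]; rewrite // /cap big_nil.
- move=> _ _ [s _ <-] [s' _ <-]; exists (s ++ s') => //.
  by rewrite /cap big_cat.
- have G0cap A : G0 A -> range cap A.
    move=> G0A; have [n _ en] := eG0 A G0A; exists [:: n] => //.
    by rewrite /cap big_seq1 /e' en mem_set.
  apply/seteqP; split.
    by rewrite mG0; exact: sub_sigma_algebra2.
  apply: smallest_sub; first exact: sigma_algebra_measurable.
  move=> _ [s _ <-]; rewrite /cap.
  apply: big_ind => //; first exact: measurableI.
  move=> n _; rewrite /e'; case: ifPn => // /set_mem G0e.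
  by rewrite mG0; exact: sub_sigma_algebra.
Qed.

Section countable_dependence.
Context d1 d2 (Z : measurableType d1) (L : measurableType d2).

(** Generates the product of the sigma-algebra of [Z] with the one generated by [C]. *)
Definition strip_system (C : set (set L)) : set (set (Z * L)) :=
  [set fst @^-1` A | A in measurable] `|` [set snd @^-1` K | K in C].

(** The sets [W] that admit such a [C] form a sigma-algebra, since countably many countable families
    can be united, and it contains all cylinders. *)
Lemma measurable_countable_dependence (W : set (Z * L)) : measurable W ->
  exists C : set (set L), [/\ countable C, C `<=` measurable &
    <<s strip_system C >> W].
Proof.
move: W; apply: smallest_sub.
  split.
  - exists set0; split => //.
    by have [] := smallest_sigma_algebra setT (strip_system set0).
  - move=> W [C [cC mC CW]]; exists C; split => //.
    by have [_ + _] := smallest_sigma_algebra setT (strip_system C); exact.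
  - move=> W /(_ _)/cid CW; exists (\bigcup_n sval (CW n)); split.
    + by apply: bigcup_countable => // n _; have [] := svalP (CW n).
    + by move=> K [n _]; have [_ + _] := svalP (CW n); exact.
    + have [_ _] := smallest_sigma_algebra setT
        (strip_system (\bigcup_n sval (CW n))); apply => n.
      have [_ _] := svalP (CW n); apply: sub_sigma_algebra2.
      apply: setUS => _ [K CK <-]; exists K => //; by exists n.
rewrite subUset; split=> [_ [A mA <-]|_ [K mK <-]]; rewrite setTI.
- exists set0; split => //; apply: sub_sigma_algebra; left; by exists A.
- exists [set K]; split => //; first by move=> _ ->.
  by apply: sub_sigma_algebra; right; exists K.
Qed.

End countable_dependence.

(** The code is the sum of [\1_(K n) / 3 ^ n]. With digits 0 and 1 in base 3 the tail never makes up
    for a missing digit, so each digit is a Borel function of the code; in base 2 two digit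
    sequences could share a value. *)
Lemma ternary_coding (R : realType) d (L : measurableType d)
    (K : (set L)^nat) : (forall n, measurable (K n)) ->
  exists2 phi : L -> R, measurable_fun setT phi &
    forall n, exists2 B : set R, measurable B & K n = phi @^-1` B.
Proof.
move=> mK.
pose x (l : L) n : R := \1_(K n) l.
pose z : R := 3^-1.
have z0 : 0 < z by rewrite invr_gt0.
have z1 : `|z| < 1 by rewrite gtr0_norm// invf_lt1// ltr1n.
pose ser l k := series (fun i => x l (k + i)%N * z ^+ i).
have x0 l n : 0 <= x l n by [].
have x1 l n : x l n <= 1 by rewrite /x indicE lern1 leq_b1.
have ser_le l k n : ser l k n <= series (geometric 1 z) n.
  by apply: ler_sum => i _; rewrite /geometric/= ler_wpM2r// exprn_ge0// ltW.
have ser_cvg l k : cvgn (ser l k).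
  apply: series_le_cvg (is_cvg_geometric_series (a := 1) z1).
  - by move=> n; rewrite mulr_ge0// exprn_ge0// ltW.
  - by move=> n; rewrite /geometric/= mul1r exprn_ge0// ltW.
  - by move=> n; rewrite /geometric/= ler_wpM2r// exprn_ge0// ltW.
(* The tail of the code from digit [k] on, rescaled so that digit [k] has weight 1; [s l 0] is the
   code itself. *)
pose s l k := limn (ser l k).
have s_ge0 l k : 0 <= s l k.
  apply: limr_ge => //; apply: nearW => n; apply: sumr_ge0 => i _.
  by rewrite mulr_ge0// exprn_ge0// ltW.
have s_le l k : s l k <= 3 / 2.
  rewrite (_ : 3 / 2 = limn (series (geometric 1 z))); last first.
    rewrite (cvg_lim _ (cvg_geometric_series z1))// /z; by field.
  apply: ler_lim => //; first exact: is_cvg_geometric_series.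
  exact: nearW.
have s_rec l k : s l k = x l k + z * s l k.+1.
  have : ser l k \o succn @ \oo --> x l k + z * s l k.+1.
    rewrite (_ : _ \o _ = fun n => x l k + z * ser l k.+1 n).
      by apply: cvgD; [exact: cvg_cst|exact: cvgMr].
    apply/funext => n; rewrite /ser /series/= big_nat_recl//= addn0 expr0 mulr1.
    congr (_ + _); rewrite mulr_sumr; apply: eq_bigr => i _.
    by rewrite addnS addSn exprS mulrCA.
  rewrite (cvg_shiftS (ser l k)) => /cvg_lim; exact.
(* The digits after the k-th one contribute at most 1/2 to s l k. *)
have s_eq1 l k : (1 <= s l k) = (l \in K k).
  rewrite s_rec /x indicE; case: (l \in K k) => /=.
    by rewrite lerDl mulr_ge0// ltW.
  apply/negbTE; rewrite -ltNge add0r.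
  by have := s_le l k.+1; rewrite /z; lra.
(* The digit shift: the leading digit, read off by comparison with 1 as in [s_eq1], is removed and
   the rest is multiplied by 3, which inverts [s_rec]. *)
pose h (y : R) : R := 3 * (y - (1 <= y)%R%:R).
have mh : measurable_fun setT h.
  apply: measurable_funM => //; apply: measurable_funB => //.
  rewrite (_ : (fun _ => _) = \1_(`[1, +oo[%classic : set R)).
    exact: measurable_indic.
  by apply/funext => y; rewrite indicE mem_setE in_itv/= andbT.
have mhn n : measurable_fun setT (iter n h).
  by elim: n => [|n ih]; [exact: measurable_id|exact: (measurableT_comp mh ih)].
have s_iter l k : s l k = iter k h (s l 0%N).
  elim: k => //= k <-; rewrite /h s_eq1 [in RHS]s_rec /x indicE /z; lra.
exists (s ^~ 0%N).
  apply: (@measurable_fun_cvg _ _ _ _ (fun n l => ser l 0%N n)).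
    move=> n; rewrite /ser /series/=; apply: measurable_sum => i.
    by apply: measurable_funM => //; exact: measurable_indic.
  by move=> l _; exact: ser_cvg.
move=> n; exists (iter n h @^-1` `[1, +oo[%classic).
  exact: (measurable_preimage (mhn n)).
apply/seteqP; split=> l /=; rewrite in_itv/= andbT -s_iter s_eq1.
  exact: mem_set.
exact: set_mem.
Qed.

(** * The distributional transform *)

(** The quantile is the supremum of the points where the distribution function is below [t]. As
    [0 < t < 1], its limits at both infinities make this set nonempty and bounded above. *)
Lemma probability_quantile (R : realType)
    (m : probability (R : Type) R) (t : R) : 0 < t < 1 ->
  exists s : R, (m `]-oo, s[%classic <= t%:E <= m `]-oo, s]%classic)%E.
Proof.
move=> /andP[t0 t1].
have mid : measurable_fun setT (fun x : R => x : R).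
  exact: measurable_id.
pose X : {RV m >-> R} := HB.pack (fun x : R => x : R)
  (isMeasurableFun.Build _ _ _ _ _ mid).
have XE r : cdf X r = m `]-oo, r]%classic by [].
pose S := [set s | (m `]-oo, s]%classic < t%:E)%E].
have ndm (r s : R) : r <= s ->
    (m `]-oo, r]%classic <= m `]-oo, s]%classic)%E.
  by move=> rs; rewrite -!XE; exact: cdf_nondecreasing.
have S0 : S !=set0.
  have : (cdf X @ -oo) [set x | (x < t%:E)%E].
    apply: (cvg_cdfNy0 X).
    apply: open_nbhs_nbhs; split; first exact: open_ereal_lt_ereal.
    by rewrite /= lte_fin.
  by move=> /(@filter_ex _ (ninfty_nbhs R) _ _)[r rt]; exists r.
have [b bt] : exists b, (t%:E < m `]-oo, b]%classic)%E.
  have : (cdf X @ +oo) [set x | (t%:E < x)%E].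
    apply: (cvg_cdfy1 X).
    apply: open_nbhs_nbhs; split; first exact: open_ereal_gt_ereal.
    by rewrite /= lte_fin.
  by move=> /(@filter_ex _ (pinfty_nbhs R) _ _)[r rt]; exists r.
have Sb : has_ubound S.
  exists b => s /= st; rewrite leNgt; apply/negP => /ltW /ndm.
  by rewrite leNgt (lt_trans st bt).
exists (sup S); apply/andP; split.
  (* Left inequality: continuity from below along [sup S - k.+1%:R^-1], where the distribution
     function is still below [t]. *)
  have -> : `]-oo, sup S[%classic =
      \bigcup_k `]-oo, sup S - k.+1%:R^-1]%classic :> set R.
    apply/seteqP; split=> x /=.
      rewrite in_itv/= => xS.
      have [k kx] : exists k, k.+1%:R^-1 < sup S - x.
        have xS0 : 0 < sup S - x by rewrite subr_gt0.
        exists (Num.truncn (sup S - x)^-1).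
        by rewrite invf_plt ?posrE// truncnS_gt.
      by exists k => //=; rewrite in_itv/= lerBrDl -lerBrDr ltW.
    move=> [k _]; rewrite /= !in_itv/= => /le_lt_trans; apply.
    by rewrite ltrBlDr ltrDl invr_gt0.
  have mcvg : (m \o (fun k => `]-oo, sup S - k.+1%:R^-1]%classic : set R))
      @ \oo --> m (\bigcup_k (`]-oo, sup S - k.+1%:R^-1]%classic : set R)).
    apply: nondecreasing_cvg_mu => //; first exact: bigcup_measurable.
    move=> i j ij; apply/subsetPset => x /=; rewrite !in_itv/= => /le_trans.
    by apply; rewrite lerD2l lerN2 lef_pV2 ?posrE// ler_nat.
  apply: cvge_le mcvg; apply: nearW => k /=.
  have [s Ss sk] : exists2 s, S s & sup S - k.+1%:R^-1 < s.
    by apply: sup_adherent => //; rewrite invr_gt0.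
  by rewrite ltW// (le_lt_trans _ Ss)// ndm// ltW.
(* Right inequality: to the right of [sup S] the distribution function is at least [t], and
   right-continuity carries this to [sup S]. *)
have := @cdf_right_continuous _ _ _ _ X (sup S).
apply: cvge_ge; near=> r.
rewrite XE leNgt; apply/negP => rS.
have : r <= sup S by exact: ub_le_sup.
by rewrite leNgt => /negP; apply; near: r; exact: nbhs_right_gt.
Unshelve. all: by end_near. Qed.

Lemma measurable_unit_val (R : realType) : measurable_fun setT (@unit_val R).
Proof. by move=> _ B mB; exists B. Qed.

Lemma unit_lebesgue_lt (R : realType) (c : R) : 0 <= c ->
  (unit_lebesgue [set x | (unit_val x < c)%R] <= c%:E)%E.
Proof.
move=> c0; have mS : measurable [set x : unit_itv R | unit_val x < c].
  exact: (measurable_preimage (@measurable_unit_val R)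
    (measurable_itv `]-oo, c[)).
have := measurable_image_unit_val mS => mi.
apply: (@le_trans _ _ (lebesgue_measure `[0, c]%classic)).
  apply: le_measure; rewrite ?inE//.
  move=> _ [x /= xc <-]; rewrite in_itv/= (ltW xc) andbT.
  by have := valP x; rewrite in_itv => /andP[].
rewrite lebesgue_measure_itv/= lte_fin; case: ifPn => //= _.
  by rewrite oppr0 adde0.
Qed.

(** Unlike the upper bound [unit_lebesgue_lt], this lower bound fails for [c] above 1. *)
Lemma unit_lebesgue_le (R : realType) (c : R) : 0 <= c <= 1 ->
  (c%:E <= unit_lebesgue [set x | (unit_val x <= c)%R])%E.
Proof.
move=> /andP[c0 c1].
have mS : measurable [set x : unit_itv R | unit_val x <= c].
  exact: (measurable_preimage (@measurable_unit_val R)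
    (measurable_itv `]-oo, c])).
have := measurable_image_unit_val mS => mi.
apply: (@le_trans _ _ (lebesgue_measure `[0, c]%classic)).
  rewrite lebesgue_measure_itv/= lte_fin; case: ifPn => //=.
    by rewrite oppr0 adde0.
  by rewrite lee_fin -leNgt.
apply: le_measure; rewrite ?inE//.
move=> x /=; rewrite in_itv/= => /andP[x0 xc].
have x01 : x \in `[0%R, 1%R] by rewrite in_itv/= x0 (le_trans xc).
by exists (exist _ x x01).
Qed.

Section distributional_transform.
Context (R : realType) d (T : measurableType d) (P : probability T R).
Variables (phi : T -> R) (v : T -> unit_itv R).
Hypotheses (mphi : measurable_fun setT phi) (mv : measurable_fun setT v).
(** Besides independence, the case [A = setT] says that [v] is uniform under [P]. *)
Hypothesis indep : forall A B, measurable A -> measurable B ->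
  P (phi @^-1` A `&` v @^-1` B) = (P (phi @^-1` A) * unit_lebesgue B)%E.

Let m : probability (R : Type) R := law P mphi.
(** [lo], [mass] and [F] are the left limit, the jump and the value at [s] of the distribution
    function of [phi]. *)
Let lo (s : R) : R := fine (m `]-oo, s[%classic).
Let mass (s : R) : R := fine (m [set s]).
Let F (s : R) : R := fine (m `]-oo, s]%classic).

Let fin_m B : measurable B -> m B \is a fin_num.
Proof. by move=> mB; exact: fin_num_measure. Qed.

Let loE s : (lo s)%:E = m `]-oo, s[%classic.
Proof. by rewrite fineK// fin_m. Qed.

Let FE s : (F s)%:E = m `]-oo, s]%classic.
Proof. by rewrite fineK// fin_m. Qed.

Let massE s : (mass s)%:E = m [set s].
Proof. by rewrite fineK// fin_m. Qed.

Let lo_ge0 s : 0 <= lo s. Proof. by rewrite -lee_fin loE measure_ge0. Qed.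

Let mass_ge0 s : 0 <= mass s.
Proof. by rewrite -lee_fin massE measure_ge0. Qed.

Let F_le1 s : F s <= 1.
Proof. by rewrite -lee_fin FE probability_le1. Qed.

Let F_split s : F s = lo s + mass s.
Proof.
apply: EFin_inj; rewrite EFinD loE massE FE -measureU//.
  by congr (m _); rewrite setUitv1.
by rewrite -subset0 => x [/= + xs]; rewrite xs in_itv/= ltxx.
Qed.

Let F_lo r s : r < s -> F r <= lo s.
Proof.
move=> rs; rewrite -lee_fin FE loE; apply: le_measure; rewrite ?inE//.
by move=> x /=; rewrite !in_itv/= => /le_lt_trans; apply.
Qed.

Let lo_F s : lo s <= F s. Proof. by rewrite F_split lerDl. Qed.

Let lo_nd : {homo lo : r s / r <= s}.
Proof.
by move=> r s; rewrite le_eqVlt => /predU1P[->//|/F_lo]; exact: le_trans.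
Qed.

Let F_nd : {homo F : r s / r <= s}.
Proof.
move=> r s; rewrite le_eqVlt => /predU1P[->//|/F_lo h].
exact: le_trans h (lo_F _).
Qed.

Let unit01 (x : unit_itv R) : 0 <= unit_val x <= 1.
Proof. by have := valP x; rewrite in_itv. Qed.

(* The mass of phi below its value, with the jump at this value spread
   uniformly by v. *)
Let g w : R := lo (phi w) + unit_val (v w) * mass (phi w).

Let g_ge w : lo (phi w) <= g w.
Proof.
by rewrite lerDl mulr_ge0//; have /andP[] := unit01 (v w).
Qed.

Let g_le w : g w <= F (phi w).
Proof.
by rewrite F_split lerD2l ler_piMl//; have /andP[] := unit01 (v w).
Qed.

Let g01 w : g w \in `[0%R, 1%R].
Proof.
by rewrite in_itv/= (le_trans (lo_ge0 _) (g_ge w)) (le_trans (g_le w)).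
Qed.

Definition dtransform w : unit_itv R := exist _ (g w) (g01 w).

Let mg : measurable_fun setT g.
Proof.
have mlo : measurable_fun setT lo by exact: nondecreasing_measurable.
have mF : measurable_fun setT F by exact: nondecreasing_measurable.
apply: measurable_funD; first exact: measurableT_comp mlo mphi.
apply: measurable_funM.
  exact: (measurableT_comp (@measurable_unit_val R) mv).
apply: (measurableT_comp (f := mass)) => //.
(* [mass] need not be monotone, but it is a difference of two monotone functions. *)
rewrite (_ : mass = F \- lo); first exact: measurable_funB.
by apply/funext => s; rewrite /= F_split addrC addKr.
Qed.

Lemma measurable_dtransform : measurable_fun setT dtransform.
Proof.
move=> _ _ [B mB <-]; rewrite !setTI.
exact: (measurable_preimage mg mB).
Qed.

Let mlt t : measurable [set w | g w < t].
Proof. exact: (measurable_preimage mg (measurable_itv `]-oo, t[)). Qed.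

Let mle t : measurable [set w | g w <= t].
Proof. exact: (measurable_preimage mg (measurable_itv `]-oo, t])). Qed.

Let mphiv A B : measurable A -> measurable B ->
  measurable (phi @^-1` A `&` v @^-1` B).
Proof.
move=> mA mB; exact: (measurableI _ _ (measurable_preimage mphi mA)
  (measurable_preimage mv mB)).
Qed.

(* For a t-quantile s of phi, g is at most t where phi < s and at least t where
   s < phi; only the atom at s has to be divided. *)
Let P_lt t : 0 < t < 1 -> (P [set w | (g w < t)%R] <= t%:E)%E.
Proof.
move=> t01; have [s] := probability_quantile m t01.
rewrite -loE -FE !lee_fin => /andP[lot tF].
pose B := [set x : unit_itv R | unit_val x * mass s < t - lo s].
have mB : measurable B.
  have mx : measurable_fun setT (fun x : unit_itv R => unit_val x * mass s).
    by apply: measurable_funM => //; exact: measurable_unit_val.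
  exact: (measurable_preimage mx (measurable_itv `]-oo, t - lo s[)).
have mA : measurable (phi @^-1` `]-oo, s[%classic).
  exact: (measurable_preimage mphi (measurable_itv _)).
apply: (@le_trans _ _
    (P (phi @^-1` `]-oo, s[%classic `|` (phi @^-1` [set s] `&` v @^-1` B)))).
  apply: le_measure; rewrite ?inE//.
    by apply: measurableU => //; exact: mphiv.
  move=> w /= gt; case: (ltgtP (phi w) s) => phis.
  - by left; rewrite /= in_itv.
  - exfalso; move: (F_lo phis) (g_ge w) => h1 h2.
    by have := lt_le_trans gt (le_trans tF (le_trans h1 h2)); rewrite ltxx.
  - right; split => //; rewrite /B/= ltrBrDl -phis; exact: gt.
have ms : measurable ([set s] : set R) by [].
apply: le_trans (measureU2 _ mA (mphiv ms mB)) _.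
rewrite [X in (X + _)%E](_ : _ = (lo s)%:E); last by rewrite loE.
rewrite [X in (_ + X)%E](indep ms mB).
rewrite [P (phi @^-1` _)](_ : _ = (mass s)%:E); last by rewrite massE.
rewrite -leeBrDl//=.
have c0 : 0 <= t - lo s by rewrite subr_ge0.
(* Without an atom at [s] the second event has probability 0, and [lo s <= t] is enough. *)
have [->|mass0] := eqVneq (mass s) 0; first by rewrite mul0e lee_fin.
have {}mass0 : 0 < mass s by rewrite lt_neqAle eq_sym mass0 mass_ge0.
have -> : B = [set x | unit_val x < (t - lo s) / mass s].
  by apply/seteqP; split=> x /=; rewrite /B/= ltr_pdivlMr.
rewrite -lee_pdivlMl// -EFinM [_^-1 * _]mulrC.
by rewrite unit_lebesgue_lt// divr_ge0// ltW.
Qed.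

(** Dual to [P_lt]: the event split at the quantile is now contained in the event [g <= t], and its
    two pieces are disjoint, so that their probabilities add up exactly. *)
Let P_le t : 0 < t < 1 -> (t%:E <= P [set w | (g w <= t)%R])%E.
Proof.
move=> t01; have [s] := probability_quantile m t01.
rewrite -loE -FE !lee_fin => /andP[lot tF].
pose B := [set x : unit_itv R | unit_val x * mass s <= t - lo s].
have mB : measurable B.
  have mx : measurable_fun setT (fun x : unit_itv R => unit_val x * mass s).
    by apply: measurable_funM => //; exact: measurable_unit_val.
  exact: (measurable_preimage mx (measurable_itv `]-oo, t - lo s])).
have mA : measurable (phi @^-1` `]-oo, s[%classic).
  exact: (measurable_preimage mphi (measurable_itv _)).
have ms : measurable ([set s] : set R) by [].
apply: (@le_trans _ _ (P (phi @^-1` `]-oo, s[%classic `|`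
    (phi @^-1` [set s] `&` v @^-1` B)))); last first.
  apply: le_measure; rewrite ?inE//.
    by apply: measurableU => //; exact: mphiv.
  move=> w [/=|[/= phis]].
    rewrite in_itv/= => phis.
    exact: le_trans (g_le w) (le_trans (F_lo phis) lot).
  by rewrite /B/= lerBrDl -phis.
rewrite measureU//; last 2 first.
- exact: (mphiv ms mB).
- by rewrite -subset0 => w [/= + [/= phis _]]; rewrite phis in_itv/= ltxx.
rewrite [X in (X + _)%E](_ : _ = (lo s)%:E); last by rewrite loE.
rewrite [X in (_ + X)%E](indep ms mB).
rewrite [P (phi @^-1` _)](_ : _ = (mass s)%:E); last by rewrite massE.
rewrite -leeBlDl//=.
have c0 : 0 <= t - lo s by rewrite subr_ge0.
(* Settles the case without an atom, and otherwise keeps the threshold [(t - lo s) / mass s] at most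
   1, as [unit_lebesgue_le] requires. *)
have cm : t - lo s <= mass s by rewrite lerBlDl -F_split.
have [mass0|mass0] := eqVneq (mass s) 0.
  by rewrite mass0 mul0e lee_fin -mass0.
have {}mass0 : 0 < mass s by rewrite lt_neqAle eq_sym mass0 mass_ge0.
have -> : B = [set x | unit_val x <= (t - lo s) / mass s].
  by apply/seteqP; split=> x /=; rewrite /B/= ler_pdivlMr.
rewrite -lee_pdivrMl// -EFinM [_^-1 * _]mulrC unit_lebesgue_le//.
by rewrite divr_ge0 ?(ltW mass0)//= ler_pdivrMr// mul1r.
Qed.

(** The event [g <= t] lies in [g < t + e] for every [e > 0], which gives the upper bound from
    [P_lt]. The endpoints are treated apart because quantiles are available only for [0 < t < 1]. *)
Let P_g t : 0 <= t <= 1 -> P [set w | g w <= t] = t%:E.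
Proof.
move=> /andP[t0 t1].
have [->|tlt1] := eqVneq t 1.
  rewrite (_ : [set w | _] = setT) ?probability_setT//.
  by apply/seteqP; split => // w _ /=; have := g01 w; rewrite in_itv => /andP[].
have {}tlt1 : t < 1 by rewrite lt_neqAle tlt1.
apply/eqP; rewrite eq_le; apply/andP; split.
  apply/lee_addgt0Pr => e e0.
  have [te1|te1] := leP 1 (t + e).
    by rewrite (le_trans (probability_le1 _ _))// -EFinD lee_fin.
  apply: le_trans (P_lt (t := t + e) _); last first.
    by rewrite te1 andbT ltr_wpDl.
  apply: le_measure; rewrite ?inE// => w /= /le_lt_trans; apply.
  by rewrite ltrDl.
have [->|tn0] := eqVneq t 0; first exact: measure_ge0.
by apply: P_le; rewrite tlt1 lt_neqAle eq_sym tn0 t0.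
Qed.

(** The law of [g] and the image of Lebesgue measure are compared as probabilities on the real line:
    they have the same distribution function, hence agree on the open upper rays, which generate the
    Borel sets and are stable under intersection. *)
Lemma dtransform_uniform (U : set (unit_itv R)) : measurable U ->
  P (dtransform @^-1` U) = unit_lebesgue U.
Proof.
move=> [B mB <-]; rewrite setTI.
pose m1 : probability (R : Type) R := law P mg.
pose m2 : probability (R : Type) R :=
  law (@unit_lebesgue R) (@measurable_unit_val R).
have m2E t : 0 <= t <= 1 -> m2 `]-oo, t]%classic = t%:E.
  move=> t01; apply/eqP; rewrite eq_le unit_lebesgue_le// andbT.
  have /andP[t0 t1] := t01.
  apply/lee_addgt0Pr => e e0.
  apply: le_trans (unit_lebesgue_lt (c := t + e) _).
    rewrite lawE; apply: (le_measure (@unit_lebesgue R)); rewrite ?inE//.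
    - exact: (measurable_preimage (@measurable_unit_val R)
        (measurable_itv `]-oo, t])).
    - exact: (measurable_preimage (@measurable_unit_val R)
        (measurable_itv `]-oo, t + e[)).
    - by move=> x /=; rewrite in_itv/= => /le_lt_trans; apply; rewrite ltrDl.
  by rewrite addr_ge0// ltW.
suff : m1 B = m2 B by [].
have m12 t : m1 `]-oo, t]%classic = m2 `]-oo, t]%classic.
  have [t0|t0] := ltP t 0.
    have m0 (x : R) : x \in `[0%R, 1%R] -> ~ x <= t.
      by rewrite in_itv => /andP[x0 _] /(le_trans x0); rewrite leNgt t0.
    transitivity (0%E : \bar R).
      rewrite lawE (_ : _ @^-1` _ = set0) ?measure0//.
      by rewrite -subset0 => w /=; rewrite in_itv; exact: m0.
    rewrite lawE (_ : _ @^-1` _ = set0) ?measure0//.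
    by rewrite -subset0 => w /=; rewrite in_itv; exact: m0 (valP w).
  have [t1|t1] := leP t 1.
    by rewrite m2E ?t0// -(@P_g t) ?t0.
  have m0 (x : R) : x \in `[0%R, 1%R] -> x <= t.
    by rewrite in_itv => /andP[_ /le_trans]; apply; exact: ltW.
  transitivity (1%E : \bar R).
    rewrite lawE (_ : _ @^-1` _ = setT) ?probability_setT//.
    by apply/seteqP; split => // w _ /=; rewrite in_itv; exact: m0.
  rewrite lawE (_ : _ @^-1` _ = setT) ?probability_setT//.
  by apply/seteqP; split => // w _ /=; rewrite in_itv; exact: m0 (valP w).
apply: (measure_unique (@RGenOInfty.G R) (fun n => `]- n%:R, +oo[%classic)).
- exact: RGenOInfty.measurableE.
- move=> _ _ [r ->] [s ->]; exists (Num.max r s).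
  by apply/seteqP; split=> x /=; rewrite !in_itv/= !andbT gt_max;
    [move=> [-> ->]|move=> /andP].
- by move=> n; exists (- n%:R).
- rewrite -subTset => x _; exists (Num.bound x) => //=.
  by rewrite in_itv/= andbT ltrNl unstable.ltrNbound.
- move=> _ [r ->].
  have -> : `]r, +oo[%classic = ~` `]-oo, r]%classic :> set R.
    by rewrite setCitvl.
  have mI : measurable (`]-oo, r]%classic : set R) by [].
  transitivity (1 - m1 `]-oo, r]%classic)%E; first exact: probability_setC.
  by rewrite m12; apply/esym/probability_setC.
- by move=> n; rewrite ltey_eq fin_num_measure.
- exact: mB.
Qed.

(** It suffices to recover the rays. The event [r < phi] agrees almost surely with the event that
    the transform exceeds [F r]. *)
Lemma dtransform_recover (B : set R) : measurable B ->
  exists2 U, measurable U &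
    {ae P, forall w, B (phi w) <-> U (dtransform w)}.
Proof.
rewrite [X in X -> _](_ : _ = (RGenOInfty.G (R := R)).-sigma.-measurable B);
  last by rewrite -RGenOInfty.measurableE.
move: B; apply: smallest_sub; first exact: ae_factor_sigma_algebra.
move=> _ [r ->].
pose U := [set x : unit_itv R | F r < unit_val x].
have mU : measurable U.
  rewrite (_ : U = @unit_val R @^-1` `]F r, +oo[%classic); last first.
    by apply/seteqP; split=> x /=; rewrite in_itv/= andbT.
  exact: (measurable_preimage (@measurable_unit_val R)
    (measurable_itv `]F r, +oo[)).
exists U => //.
have mA : measurable [set w | phi w <= r].
  exact: (measurable_preimage mphi (measurable_itv `]-oo, r])).
have sub : [set w | phi w <= r] `<=` [set w | g w <= F r].
  by move=> w /= /F_nd; exact: le_trans (g_le w).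
(* The exceptional set is null because the smaller event is contained in the larger and both have
   probability [F r]. *)
exists ([set w | g w <= F r] `\` [set w | phi w <= r]); split.
- exact: measurableD.
- rewrite measureD//; last by rewrite ltey_eq fin_num_measure.
  have Fr01 : 0 <= F r <= 1 by rewrite F_le1 (le_trans (lo_ge0 r)).
  rewrite [X in (X - _)%E](P_g Fr01) (setIidr sub).
  by rewrite [X in (_ - X)%E](_ : _ = (F r)%:E) ?subee// FE.
- move=> w /=; rewrite in_itv/= andbT; case: (leP (phi w) r) => phir niff.
    exfalso; apply: niff; split=> //; rewrite /U/= ltNge.
    by rewrite (le_trans (g_le w))// F_nd.
  by split => //; rewrite leNgt; apply/negP => Fg; apply: niff.
Qed.

End distributional_transform.

(** [tau] is the distributional transform of the ternary code of [C], with the second coordinate of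
    the product as independent uniform noise. *)
Lemma uniform_factor (R : realType) d (L : measurableType d)
    (l : probability L R) (C : set (set L)) :
  countable C -> C `<=` measurable ->
  exists tau : L * unit_itv R -> unit_itv R,
    [/\ measurable_fun setT tau,
        forall U, measurable U ->
          (l \x @unit_lebesgue R)%E (tau @^-1` U) = unit_lebesgue U &
        forall K, C K -> exists2 U, measurable U &
          {ae (l \x @unit_lebesgue R)%E, forall z, K z.1 <-> U (tau z)}].
Proof.
move=> /pcard_surjP[e eC] mC.
pose K n := if e n \in C then e n else setT.
have mK n : measurable (K n).
  by rewrite /K; case: ifPn => // /set_mem; exact: mC.
have [phi mphi Kphi] := ternary_coding R mK.
pose P : probability (L * unit_itv R)%type R := (l \x @unit_lebesgue R)%E.
have mphi1 : measurable_fun setT (phi \o fst : L * unit_itv R -> R).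
  exact: measurableT_comp.
have msnd : measurable_fun setT (snd : L * unit_itv R -> unit_itv R).
  exact: measurable_snd.
have PX A B : measurable A -> measurable B ->
    P (A `*` B) = (l A * unit_lebesgue B)%E.
  by move=> mA mB; exact: product_measure1E.
have indep A B : measurable A -> measurable B ->
    P ((phi \o fst) @^-1` A `&` snd @^-1` B) =
    (P ((phi \o fst) @^-1` A) * unit_lebesgue B)%E.
  move=> mA mB; have mphiA := measurable_preimage mphi mA.
  rewrite (_ : _ `&` _ = (phi @^-1` A) `*` B)//.
  rewrite (_ : (_ \o _) @^-1` A = (phi @^-1` A) `*` setT); last first.
    by apply/seteqP; split=> x //= [].
  rewrite !PX//.
  by rewrite (@probability_setT _ _ _ (@unit_lebesgue R)) mule1.
exists (dtransform P snd mphi1); split.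
- exact: measurable_dtransform.
- by move=> U mU; exact: dtransform_uniform.
- move=> A CA; have [n _ en] := eC A CA.
  have [B mB KB] := Kphi n.
  have [U mU BU] := dtransform_recover mphi1 msnd indep mB.
  exists U => //; apply: filterS BU => z.
  rewrite -en; have <- : K n = e n by rewrite /K en mem_set.
  by rewrite KB.
Qed.

(** * Randomising the hidden variable *)

Section product_sections.
Context (R : realType) d1 d2 (T1 : measurableType d1) (T2 : measurableType d2).
Variables (p : probability T1 R) (q : probability T2 R).

(** Tonelli with the noise coordinate outermost: once it is frozen, the randomised variable is a
    function of the original hidden variable alone. *)
Lemma ge0_integral_ysection (D : set (T1 * T2)) (f : T1 * T2 -> \bar R) :
  measurable D -> measurable_fun setT f -> (forall w, 0 <= f w)%E ->
  (\int[p \x q]_(w in D) f w =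
   \int[q]_y \int[p]_(x in ysection D y) f (x, y))%E.
Proof.
move=> mD mf f0; rewrite integral_mkcond fubini_tonelli2.
- apply: eq_integral => y _; rewrite /fubini_G [RHS]integral_mkcond.
  by apply: eq_integral => x _; rewrite !patchE mem_ysection.
- by apply/(measurable_restrictT _ mD); exact: measurable_funTS.
- by move=> w; rewrite patchE; case: ifP.
Qed.

Lemma product_measure_ysection (D : set (T1 * T2)) : measurable D ->
  ((p \x q) D = \int[q]_y p (ysection D y))%E.
Proof.
move=> mD; rewrite -[LHS]mul1e -integral_cst// ge0_integral_ysection//.
apply: eq_integral => y _; rewrite integral_cst ?mul1e//.
exact: measurable_ysection.
Qed.

(** Transports statements about [tau] from the law of the hidden variable to the full sample space;
    both measures agree on rectangles. *)
Lemma law_product d3 (T3 : measurableType d3) (h : T1 -> T3)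
    (mh : measurable_fun setT h) (A : set (T3 * T2)) : measurable A ->
  (law p mh \x q)%E A = (p \x q)%E ((fun w => (h w.1, w.2)) @^-1` A).
Proof.
move=> mA; have mh2 : measurable_fun setT
    (fun w : T1 * T2 => (h w.1, w.2)).
  apply: measurable_fun_pair; last exact: measurable_snd.
  exact: measurableT_comp.
pose P : probability (T1 * T2)%type R := (p \x q)%E.
rewrite -[RHS]/(law P mh2 A); apply: product_measure_unique => // B C mB mC.
rewrite -(product_measure1E p q (measurable_preimage mh mB) mC).
by [].
Qed.

Lemma product_measure_fst (A : set T1) : measurable A ->
  (p \x q)%E (fst @^-1` A) = p A.
Proof.
move=> mA; rewrite (_ : fst @^-1` A = A `*` setT).
  rewrite [LHS](product_measure1E p q)//.
  by rewrite [X in (_ * X)%E](probability_setT q) mule1.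
by apply/seteqP; split=> x //= [].
Qed.

Lemma ae_product_fst (Q : set T1) : {ae p, forall x, Q x} ->
  {ae (p \x q)%E, forall w, Q w.1}.
Proof.
move=> [N [mN N0 QN]]; exists (fst @^-1` N); split.
- by apply: measurable_preimage mN; exact: measurable_fst.
- by rewrite product_measure_fst.
- by move=> w /= Qw; exact: QN.
Qed.

End product_sections.

(** * Conditioning on the randomised variable *)

Section randomised_conditioning.
Context (R : realType) d dL dZ (T : measurableType d) (L : measurableType dL)
  (Z : measurableType dZ).
Variables (p : probability T R) (la : T -> L) (f : T -> Z).
Hypotheses (mla : measurable_fun setT la) (mf : measurable_fun setT f).
Variable tau : L * unit_itv R -> unit_itv R.
Hypothesis mtau : measurable_fun setT tau.

Let P : probability (T * unit_itv R)%type R := (p \x @unit_lebesgue R)%E.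
Let fl w := (f w, la w).
Let ft (w : T * unit_itv R) := (f w.1, tau (la w.1, w.2)).

Let mfl : measurable_fun setT fl.
Proof. exact: measurable_fun_pair. Qed.

Let mft : measurable_fun setT ft.
Proof.
apply: measurable_fun_pair; first exact: measurableT_comp.
apply: (measurableT_comp mtau); apply: measurable_fun_pair => //.
exact: measurableT_comp.
Qed.

(* tau adds to la only independent noise, which does not change the
   conditional probability of an event of T. *)
Lemma cond_prob_randomised (A : set T) (B : set (Z * unit_itv R)) :
  measurable A -> measurable B ->
  P (fst @^-1` A `&` ft @^-1` B) =
  (\int[P]_(w in ft @^-1` B) (cond_prob p A fl (fl w.1))%:E)%E.
Proof.
move=> mA mB; have mD := measurable_preimage mft mB.
have mA1 : measurable (fst @^-1` A : set (T * unit_itv R)).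
  by apply: measurable_preimage mA; exact: measurable_fst.
rewrite [LHS](product_measure_ysection p (@unit_lebesgue R)); last first.
  exact: measurableI.
rewrite (ge0_integral_ysection p (@unit_lebesgue R)
  (f := fun w => (cond_prob p A fl (fl w.1))%:E))//; last 2 first.
- apply/measurable_EFinP.
  apply: (measurableT_comp (measurable_cond_prob p mfl mA)).
  exact: measurableT_comp mfl _.
- by move=> w; rewrite lee_fin cond_prob_ge0.
apply: eq_integral => y _.
(* For frozen noise [y] the conditioning event is an event of [fl], where the defining identity of
   the original conditional probability applies. *)
pose By := [set zl : Z * L | B (zl.1, tau (zl.2, y))].
have mBy : measurable By.
  have my : measurable_fun setT (fun zl : Z * L => (zl.2, y)).
    by apply: measurable_fun_pair => //; exact: measurable_snd.
  have mBy : measurable_fun setT (fun zl : Z * L => (zl.1, tau (zl.2, y))).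
    apply: measurable_fun_pair; first exact: measurable_fst.
    exact: (measurableT_comp mtau my).
  exact: (measurable_preimage mBy mB).
have -> : ysection (ft @^-1` B) y = fl @^-1` By.
  by apply/seteqP; split=> x; rewrite /ysection/= ?inE.
rewrite -(integral_cond_prob p mfl mA mBy); congr (p _).
by apply/seteqP; split=> x; rewrite /ysection/= ?inE.
Qed.

(** Conditioning on the randomised variable loses nothing for [A]; every property involving outcomes
    is carried over in this form. *)
Definition transfers (A : set T) := {ae P, forall w,
  cond_prob P (fst @^-1` A) ft (ft w) = cond_prob p A fl (fl w.1)}.

Let mfst A : measurable A -> measurable (fst @^-1` A : set (T * unit_itv R)).
Proof. exact: (measurable_preimage measurable_fst). Qed.

(** This and [transfers_bigcup] are the closure steps of a Dynkin induction: both conditional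
    probabilities obey the same rule almost surely. *)
Lemma transfersC A : measurable A -> transfers A -> transfers (~` A).
Proof.
move=> mA tA.
have PA := cond_probC P mft (mfst mA).
have pA : {ae P, forall w,
    cond_prob p (~` A) fl (fl w.1) = 1 - cond_prob p A fl (fl w.1)}.
  exact: ae_product_fst (cond_probC p mfl mA).
move: tA pA PA; rewrite /transfers; apply: filterS3 => w tA pA PA.
by rewrite preimage_setC PA tA -pA.
Qed.

Lemma transfers_bigcup (A : (set T)^nat) : (forall n, measurable (A n)) ->
  trivIset setT A -> (forall n, transfers (A n)) -> transfers (\bigcup_n A n).
Proof.
move=> mA ttA tA.
have t1A : trivIset setT (fun n => fst @^-1` (A n) : set (T * unit_itv R)).
  move=> i j _ _ [w [Aiw Ajw]]; apply: (ttA i j) => //; by exists w.1.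
have PA := cond_prob_bigcup P mft (fun n => mfst (mA n)) t1A.
have pA : {ae P, forall w,
    (cond_prob p (\bigcup_n A n) fl (fl w.1))%:E =
    (\sum_(n <oo) (cond_prob p (A n) fl (fl w.1))%:E)%E}.
  exact: ae_product_fst (cond_prob_bigcup p mfl mA ttA).
move: (ae_foralln tA) pA PA; rewrite /transfers.
apply: filterS3 => w tAw pAw PAw.
apply: EFin_inj; rewrite preimage_bigcup PAw pAw.
by apply: eq_eseriesr => n _; rewrite tAw.
Qed.

Variable C : set (set L).
Hypothesis tauC : forall K, C K -> exists2 U, measurable U &
  {ae P, forall w, K (la w.1) <-> U (tau (la w.1, w.2))}.

(** Strips over [Z] are kept by the first component of [ft], strips over [C] are recovered by
    [tauC], and [ae_factor_sigma_algebra] extends this to the generated sigma-algebra. *)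
Lemma strip_system_factor W : <<s strip_system C >> W ->
  exists2 E, measurable E & {ae P, forall w, W (fl w.1) <-> E (ft w)}.
Proof.
move: W; apply: smallest_sub; first exact: ae_factor_sigma_algebra.
move=> _ [[A mA <-]|[K CK <-]].
  exists (fst @^-1` A); last exact: aeW.
  exact: (measurable_preimage measurable_fst mA).
have [U mU KU] := tauC CK; exists (snd @^-1` U) => //.
exact: (measurable_preimage measurable_snd mU).
Qed.

(** By the hypothesis on its level sets, the original conditional probability is almost surely a
    measurable function [k] of [ft]. By [cond_prob_randomised] it has the required integrals, so
    uniqueness applies. *)
Lemma transfers_strip_system A : measurable A ->
  (forall q : rat,
    <<s strip_system C >> [set z | ratr q < cond_prob p A fl z]) ->
  transfers A.
Proof.
move=> mA WA; set g := cond_prob p A fl.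
(* g is the supremum of the rationals below it. *)
pose q n : rat := odflt 0 (unpickle n).
have qK r : q (pickle r) = r by rewrite /q pickleK.
have [E mE aeE] : exists2 E : (set (Z * unit_itv R))^nat,
    forall n, measurable (E n) &
    forall n, {ae P, forall w, (ratr (q n) < g (fl w.1)) <-> E n (ft w)}.
  have /(_ _)/cid2 E n := strip_system_factor (WA (q n)).
  by exists (fun n => s2val (E n)) => n;
    [exact: s2valP (E n)|exact: s2valP' (E n)].
(* Off [E n] the term is 0, which cannot spoil the supremum because [g] is nonnegative. *)
pose term n z : \bar R := (ratr (q n) * \1_(E n) z)%:E.
pose k z := esups (term ^~ z) 0%N.
have mterm n : measurable_fun setT (term n).
  by apply/measurable_EFinP; exact: measurable_funM.
have term_k n z : (term n z <= k z)%E by apply: ereal_sup_ubound; exists n.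
have mk : measurable_fun setT k by exact: measurable_fun_esups.
have k0 z : (0 <= k z)%E.
  apply: le_trans (term_k (pickle (0 : rat)) z).
  by rewrite /term qK rmorph0 mul0r.
have kg : {ae P, forall w, (g (fl w.1))%:E = k (ft w)}.
  move: (ae_foralln aeE); apply: filterS => w Ew.
  have termE n : term n (ft w) =
      if ratr (q n) < g (fl w.1) then (ratr (q n))%:E else 0%E.
    rewrite /term indicE; case: ifPn => [/Ew/mem_set ->|qg].
      by rewrite mulr1.
    by rewrite memNset ?mulr0// => /Ew; exact/negP.
  apply/eqP; rewrite eq_le; apply/andP; split.
    rewrite leNgt; apply/negP => kg.
    have kfin : k (ft w) \is a fin_num.
      by rewrite ge0_fin_numE// (lt_trans kg)// ltry.
    (* A rational strictly between [k] and [g] would index a term above the supremum. *)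
    have /rat_in_itvoo[r] : fine (k (ft w)) < g (fl w.1).
      by rewrite -lte_fin fineK.
    rewrite in_itv/= => /andP[kr rg].
    have := term_k (pickle r) (ft w); rewrite termE qK rg leNgt.
    by rewrite -(fineK kfin) lte_fin kr.
  apply: ge_ereal_sup => _ [n _ <-]; rewrite termE.
  by case: ifPn => [/ltW|_]; rewrite lee_fin// cond_prob_ge0.
have kE B : measurable B -> P (fst @^-1` A `&` ft @^-1` B) =
    (\int[P]_(w in ft @^-1` B) k (ft w))%E.
  move=> mB; rewrite cond_prob_randomised//.
  apply: ae_eq_integral.
  - exact: (measurable_preimage mft mB).
  - apply/measurable_funTS/measurable_EFinP.
    apply: (measurableT_comp (measurable_cond_prob p mfl mA)).
    exact: measurableT_comp mfl _.
  - by apply: measurable_funTS; exact: (measurableT_comp mk mft).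
  - by apply: filterS kg => w -> _.
have kP := cond_prob_unique mft (mfst mA) mk k0 kE.
move: kg kP; rewrite /transfers; apply: filterS2 => w kgw kPw.
by apply: EFin_inj; rewrite kPw -kgw.
Qed.

End randomised_conditioning.

(** Only the level sets at rationals, for events from a countable generator stable under
    intersection, have to be recovered; each involves countably many sets of [L]. [C] is thus fixed
    before [tau] is chosen, and Dynkin induction reaches all events. *)
Lemma transfers_countable (R : realType) d dL dZ dX (T : measurableType d)
    (L : measurableType dL) (Z : measurableType dZ) (X : measurableType dX)
    (p : probability T R) (la : T -> L) (f : T -> Z) (e : T -> X) :
  countably_generated X -> measurable_fun setT la -> measurable_fun setT f ->
  measurable_fun setT e ->
  exists C : set (set L), [/\ countable C, C `<=` measurable &
    forall tau : L * unit_itv R -> unit_itv R, measurable_fun setT tau ->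
    (forall K, C K -> exists2 U, measurable U &
      {ae (p \x @unit_lebesgue R)%E,
        forall w, K (la w.1) <-> U (tau (la w.1, w.2))}) ->
    forall S, measurable S -> transfers p la f tau (e @^-1` S)].
Proof.
move=> /countable_setI_closed_generator[G [cG GT GI mG]] mla mf me.
have mGm S : G S -> measurable S.
  by move=> GS; rewrite mG; exact: sub_sigma_algebra.
have mfl : measurable_fun setT (fun w => (f w, la w)).
  exact: measurable_fun_pair.
pose W (S : set X) (q : rat) : set (Z * L) :=
  [set z | ratr q < cond_prob p (e @^-1` S) (fun w => (f w, la w)) z].
(* The condition [G S] stands under the existential so that a family can be chosen for every [S],
   with [set0] as default outside [G]. *)
have /(_ _ _)/cid CW (S : set X) (q : rat) : exists C : set (set L), G S ->
    [/\ countable C, C `<=` measurable & <<s strip_system C >> (W S q)].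
  have [GS|nGS] := pselect (G S); last by exists set0.
  have meS := measurable_preimage me (mGm _ GS).
  have : measurable (W S q).
    rewrite (_ : W S q = cond_prob p (e @^-1` S) (fun w => (f w, la w)) @^-1`
        `]ratr q, +oo[%classic).
      exact: (measurable_preimage (measurable_cond_prob p mfl meS)).
    by apply/seteqP; split=> z /=; rewrite in_itv/= andbT.
  by move=> /measurable_countable_dependence[C HC]; exists C.
exists (\bigcup_(S in G) \bigcup_q sval (CW S q)); split.
- apply: bigcup_countable => // S GS; apply: bigcup_countable => // q _.
  by have [] := svalP (CW S q) GS.
- move=> K [S GS [q _]].
  by have [_ + _] := svalP (CW S q) GS; exact.
move=> tau mtau tauC S; rewrite mG; move: S.
have GP S : G S -> transfers p la f tau (e @^-1` S).
  move=> GS; apply: (transfers_strip_system mla mf mtau tauC).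
    exact: (measurable_preimage me (mGm _ GS)).
  move=> q; have [_ _] := svalP (CW S q) GS; apply: sub_sigma_algebra2.
  by apply: setUS => _ [K CK <-]; exists K => //; exists S => //; exists q.
apply: (dynkin_induction mG GI) => //.
- exact: GP.
- move=> S mS; rewrite preimage_setC; apply: transfersC => //.
  exact: (measurable_preimage me mS).
- move=> F mF tF FP; rewrite preimage_bigcup; apply: transfers_bigcup => //.
    by move=> n; exact: (measurable_preimage me (mF n)).
  by move=> i j _ _ [w [Fiw Fjw]]; apply: (tF i j) => //; exists (e w).
Qed.

(** For each frozen noise value the event of [tau] is an event of [la], to which the product formula
    applies; integrating over the noise gives the claim. *)
Lemma independent_randomised (R : realType) d dL (T : measurableType d)
    (L : measurableType dL) (p : probability T R) (la : T -> L)
    (tau : L * unit_itv R -> unit_itv R) (S : set T) :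
  measurable_fun setT la -> measurable_fun setT tau -> measurable S ->
  (forall K, measurable K -> p (la @^-1` K `&` S) = p (la @^-1` K) * p S)%E ->
  forall U, measurable U ->
  (p \x @unit_lebesgue R)%E
    ((fun w => tau (la w.1, w.2)) @^-1` U `&` fst @^-1` S) =
  ((p \x @unit_lebesgue R) ((fun w => tau (la w.1, w.2)) @^-1` U) * p S)%E.
Proof.
move=> mla mtau mS indep U mU.
have mt : measurable_fun setT
    (fun w : T * unit_itv R => tau (la w.1, w.2)).
  apply: (measurableT_comp mtau); apply: measurable_fun_pair => //.
  exact: measurableT_comp.
have mD := measurable_preimage mt mU.
have mS1 : measurable (fst @^-1` S : set (T * unit_itv R)).
  exact: (measurable_preimage measurable_fst).
rewrite !product_measure_ysection//; last exact: measurableI.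
rewrite -ge0_integralZr//; last exact: measurable_fun_ysection.
apply: eq_integral => y _.
pose Uy := [set l : L | U (tau (l, y))].
have mUy : measurable Uy.
  have my : measurable_fun setT (fun l : L => tau (l, y)).
    exact: (measurable_fun_pair1 y mtau).
  exact: (measurable_preimage my mU).
transitivity (p (la @^-1` Uy `&` S)).
  by congr (p _); apply/seteqP; split=> x; rewrite /ysection/= ?inE.
rewrite indep//; congr (p _ * _)%E.
by apply/seteqP; split=> x; rewrite /ysection/= ?inE.
Qed.

(** * Hidden-variable models *)

Section measurable_projections.
Context {da db ea eb dm : measure_display}
  {Xa : measurableType da} {Xb : measurableType db}
  {Ya : measurableType ea} {Yb : measurableType eb} {M : measurableType dm}.

Lemma measurable_projXY : measurable_fun setT (@projXY Xa Xb Ya Yb M).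
Proof. exact: measurable_fst. Qed.

Lemma measurable_projL : measurable_fun setT (@projL Xa Xb Ya Yb M).
Proof. exact: measurable_snd. Qed.

Lemma measurable_projX : measurable_fun setT (@projX Xa Xb Ya Yb M).
Proof. exact: (measurableT_comp measurable_fst measurable_projXY). Qed.

Lemma measurable_projY : measurable_fun setT (@projY Xa Xb Ya Yb M).
Proof. exact: (measurableT_comp measurable_snd measurable_projXY). Qed.

Lemma measurable_projYa :
  measurable_fun setT (fun w : (Xa * Xb) * (Ya * Yb) * M => (projY w).1).
Proof. exact: (measurableT_comp measurable_fst measurable_projY). Qed.

Lemma measurable_projYb :
  measurable_fun setT (fun w : (Xa * Xb) * (Ya * Yb) * M => (projY w).2).
Proof. exact: (measurableT_comp measurable_snd measurable_projY). Qed.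

Lemma measurable_projYL : measurable_fun setT (@projYL Xa Xb Ya Yb M).
Proof. exact: (measurable_fun_pair measurable_projY measurable_projL). Qed.

Lemma measurable_projYaL : measurable_fun setT (@projYaL Xa Xb Ya Yb M).
Proof. exact: (measurable_fun_pair measurable_projYa measurable_projL). Qed.

Lemma measurable_projYbL : measurable_fun setT (@projYbL Xa Xb Ya Yb M).
Proof. exact: (measurable_fun_pair measurable_projYb measurable_projL). Qed.

End measurable_projections.

Theorem theorem1 (R : realType) (da db ea eb : measure_display)
    (Xa : measurableType da) (Xb : measurableType db)
    (Ya : measurableType ea) (Yb : measurableType eb)
    (hX : countably_generated (Xa * Xb)%type)
    (hY : countably_generated (Ya * Yb)%type)
    (dl : measure_display) (L : measurableType dl)
    (p : hidden_variable_model Xa Xb Ya Yb L R) :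
  exists pbar : hidden_variable_model Xa Xb Ya Yb (unit_itv R) R,
    [/\ forall B : set (unit_itv R), measurable B ->
          pushforward pbar projL B = unit_lebesgue B,
        realization_equivalent p pbar &
        [/\ (parameter_independence p -> parameter_independence pbar),
            (outcome_independence p -> outcome_independence pbar),
            (locality p -> locality pbar),
            (lambda_independence p -> lambda_independence pbar) &
            (strong_determinism p -> strong_determinism pbar) /\
            (weak_determinism p -> weak_determinism pbar)]].
Proof.
set W := ((Xa * Xb) * (Ya * Yb) * L)%type.
set W' := ((Xa * Xb) * (Ya * Yb) * unit_itv R)%type.
have [C [cC mC HC]] :=
  transfers_countable p hX measurable_projL measurable_projY measurable_projX.
have [Ca [cCa mCa HCa]] :=
  transfers_countable p hX measurable_projL measurable_projYa measurable_projX.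
have [Cb [cCb mCb HCb]] :=
  transfers_countable p hX measurable_projL measurable_projYb measurable_projX.
(* A single [tau] has to serve all three conditionings, so the three families are merged; every
   index from 2 on gives [Cb]. *)
pose CC n := if n is n'.+1 then (if n' is 0%N then Ca else Cb) else C.
have cCC : countable (\bigcup_n CC n) by apply: bigcup_countable => // -[|[]].
have mCC : \bigcup_n CC n `<=` measurable.
  by move=> K [[|[|n]] _]; [exact: mC|exact: mCa|exact: mCb].
pose l : probability L R := law p measurable_projL.
have [tau [mtau tauu tauC]] := uniform_factor l cCC mCC.
pose P : probability (W * unit_itv R)%type R := (p \x @unit_lebesgue R)%E.
pose h (w : W * unit_itv R) := (projL w.1, w.2).
have mh : measurable_fun setT h.
  apply: measurable_fun_pair => //.
  exact: (measurableT_comp measurable_projL).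
(* The properties of [tau] hold under [l] times Lebesgue measure; here and in [tauu] they are pulled
   back along [h] to [P]. *)
have {}tauC K : (\bigcup_n CC n) K -> exists2 U, measurable U &
    {ae P, forall w, K (projL w.1) <-> U (tau (projL w.1, w.2))}.
  move=> /tauC[U mU [N [mN N0 KU]]]; exists U => //.
  exists (h @^-1` N); split; first exact: (measurable_preimage mh mN).
    by rewrite -N0 (law_product p (@unit_lebesgue R) measurable_projL mN).
  by move=> w nw; exact: KU.
have {}tauu U : measurable U ->
    P ((fun w => tau (projL w.1, w.2)) @^-1` U) = unit_lebesgue U.
  move=> mU; have mtU := measurable_preimage mtau mU.
  by rewrite -tauu// (law_product p (@unit_lebesgue R) measurable_projL mtU).
have {}HC S := HC tau mtau (fun K CK => tauC K (ex_intro2 _ _ 0%N I CK)) S.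
have {}HCa S := HCa tau mtau (fun K CK => tauC K (ex_intro2 _ _ 1%N I CK)) S.
have {}HCb S := HCb tau mtau (fun K CK => tauC K (ex_intro2 _ _ 2%N I CK)) S.
pose sample (w : W * unit_itv R) : W' := (w.1.1, tau (h w)).
have msample : measurable_fun setT sample.
  apply: measurable_fun_pair; last exact: (measurableT_comp mtau mh).
  exact: (measurableT_comp measurable_projXY).
pose pbar : probability W' R := law P msample.
have mXS (S : set (Xa * Xb)) : measurable S ->
    measurable (projX @^-1` S : set W').
  exact: (measurable_preimage measurable_projX).
(* Along [sample], the conditional probabilities of [pbar] coincide almost surely with those of [p],
   for each of the three conditionings. *)
have TY S : measurable S -> {ae P, forall w,
    cond_prob pbar (projX @^-1` S) projYL (projYL (sample w)) =
    cond_prob p (projX @^-1` S) projYL (projYL w.1)}.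
  move=> mS; rewrite (cond_prob_law P msample (mXS _ mS) measurable_projYL).
  exact: HC.
have TYa S : measurable S -> {ae P, forall w,
    cond_prob pbar (projX @^-1` S) projYaL (projYaL (sample w)) =
    cond_prob p (projX @^-1` S) projYaL (projYaL w.1)}.
  move=> mS; rewrite (cond_prob_law P msample (mXS _ mS) measurable_projYaL).
  exact: HCa.
have TYb S : measurable S -> {ae P, forall w,
    cond_prob pbar (projX @^-1` S) projYbL (projYbL (sample w)) =
    cond_prob p (projX @^-1` S) projYbL (projYbL w.1)}.
  move=> mS; rewrite (cond_prob_law P msample (mXS _ mS) measurable_projYbL).
  exact: HCb.
have aeP (Q : set W) : {ae p, forall w, Q w} -> {ae P, forall w, Q w.1}.
  exact: ae_product_fst.
pose cY S (w : W') := cond_prob pbar (projX @^-1` S) projYL (projYL w).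
pose cYa S (w : W') := cond_prob pbar (projX @^-1` S) projYaL (projYaL w).
pose cYb S (w : W') := cond_prob pbar (projX @^-1` S) projYbL (projYbL w).
have mcY S : measurable S -> measurable_fun setT (cY S).
  by move=> /mXS; exact: (measurable_cond_prob_comp pbar measurable_projYL).
have mcYa S : measurable S -> measurable_fun setT (cYa S).
  by move=> /mXS; exact: (measurable_cond_prob_comp pbar measurable_projYaL).
have mcYb S : measurable S -> measurable_fun setT (cYb S).
  by move=> /mXS; exact: (measurable_cond_prob_comp pbar measurable_projYbL).
(* Events of a single outcome are cylinders in [Xa * Xb], so the transfer statements for [projX]
   cover them too. *)
have mSa (Ja : set Xa) : measurable Ja ->
    measurable (fst @^-1` Ja : set (Xa * Xb)).
  exact: (measurable_preimage measurable_fst).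
have mSb (Jb : set Xb) : measurable Jb ->
    measurable (snd @^-1` Jb : set (Xa * Xb)).
  exact: (measurable_preimage measurable_snd).
have pbarL U : measurable U -> pbar (projL @^-1` U) = unit_lebesgue U.
  exact: tauu.
exists pbar; split.
- exact: pbarL.
(* The common empirical model is the [projXY] law of [p], since [sample] leaves these coordinates
   unchanged. *)
- exists (law p measurable_projXY); split => // B mB.
  rewrite [LHS]lawE.
  rewrite -(product_measure_fst p (@unit_lebesgue R))//.
  exact: (measurable_preimage measurable_projXY mB).
split.
- move=> [pia pib]; split=> [Ja mJa|Jb mJb].
    (* The pattern for all equational properties: pass from [pbar] to [P], then replace each
       conditional probability by the original one. *)
    apply: (ae_law_eq msample (mcY _ (mSa _ mJa)) (mcYa _ (mSa _ mJa))).
    move: (TY _ (mSa _ mJa)) (TYa _ (mSa _ mJa)) (aeP _ (pia _ mJa)).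
    by apply: filterS3 => w h1 h2 h3; rewrite /cY /cYa h1 h2.
  apply: (ae_law_eq msample (mcY _ (mSb _ mJb)) (mcYb _ (mSb _ mJb))).
  move: (TY _ (mSb _ mJb)) (TYb _ (mSb _ mJb)) (aeP _ (pib _ mJb)).
  by apply: filterS3 => w h1 h2 h3; rewrite /cY /cYb h1 h2.
- move=> oi Ja Jb mJa mJb; have mJ := measurableX mJa mJb.
  apply: (ae_law_eq msample (mcY _ mJ)
    (measurable_funM (mcY _ (mSa _ mJa)) (mcY _ (mSb _ mJb)))).
  near=> w; rewrite /= /cY (near (TY _ mJ) w)//.
  rewrite (near (TY _ (mSa _ mJa)) w)// (near (TY _ (mSb _ mJb)) w)//.
  exact: (near (aeP _ (oi _ _ mJa mJb))).
- move=> lo Ja Jb mJa mJb; have mJ := measurableX mJa mJb.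
  apply: (ae_law_eq msample (mcY _ mJ)
    (measurable_funM (mcYa _ (mSa _ mJa)) (mcYb _ (mSb _ mJb)))).
  near=> w; rewrite /= /cY /cYa /cYb (near (TY _ mJ) w)//.
  rewrite (near (TYa _ (mSa _ mJa)) w)// (near (TYb _ (mSb _ mJb)) w)//.
  exact: (near (aeP _ (lo _ _ mJa mJb))).
(* This property conditions on [projY] alone, so the transfer statements do not apply; instead the
   constant [unit_lebesgue U] is shown to have the defining integrals. *)
- move=> li U mU.
  have -> : pushforward pbar projL U = (fine (unit_lebesgue U))%:E.
    rewrite fineK; first exact: pbarL.
    exact: (fin_num_measure (@unit_lebesgue R)).
  apply: (@cond_prob_unique _ _ _ _ _ pbar projY measurable_projY
    (projL @^-1` U) (cst (fine (unit_lebesgue U))%:E)) => //.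
  + exact: (measurable_preimage measurable_projL mU).
  + by move=> y; rewrite lee_fin fine_ge0// measure_ge0.
  move=> B mB.
  have mYB : measurable (projY @^-1` B : set W).
    exact: (measurable_preimage measurable_projY mB).
  rewrite integral_cst; last exact: (measurable_preimage measurable_projY mB).
  rewrite fineK; last exact: (fin_num_measure (@unit_lebesgue R)).
  rewrite -(tauu _ mU).
  rewrite [X in (_ * X)%E](_ : _ = p (projY @^-1` B)); last first.
    exact: (product_measure_fst p (@unit_lebesgue R) mYB).
  apply: (independent_randomised measurable_projL mtau mYB) => // K mK.
  have mLK : measurable (projL @^-1` K : set W).
    exact: (measurable_preimage measurable_projL mK).
  rewrite (integral_cond_prob p measurable_projY mLK mB).
  (* Integrating the property of [p] over an event of [projY] gives the product formula needed by
     [independent_randomised]. *)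
  transitivity (\int[p]_(w in projY @^-1` B) (p (projL @^-1` K)))%E.
    apply: ae_eq_integral => //.
    - apply/measurable_funTS/measurable_EFinP.
      exact: (measurable_cond_prob_comp p measurable_projY mLK).
    - by apply: filterS (li K mK) => w hw _.
  by rewrite integral_cst.
split.
- move=> [sda sdb]; split=> [Ja mJa|Jb mJb].
    apply: (ae_law_in01 msample (mcYa _ (mSa _ mJa))).
    move: (TYa _ (mSa _ mJa)) (aeP _ (sda _ mJa)).
    by apply: filterS2 => w; rewrite /cYa => ->.
  apply: (ae_law_in01 msample (mcYb _ (mSb _ mJb))).
  move: (TYb _ (mSb _ mJb)) (aeP _ (sdb _ mJb)).
  by apply: filterS2 => w; rewrite /cYb => ->.
- move=> wd Ja Jb mJa mJb; have mJ := measurableX mJa mJb.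
  apply: (ae_law_in01 msample (mcY _ mJ)).
  move: (TY _ mJ) (aeP _ (wd _ _ mJa mJb)).
  by apply: filterS2 => w; rewrite /cY => ->.
Unshelve. all: by end_near.
Qed.
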